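(* For every binary quartic $f\in\mathcal{Q}_2^4$ and every $(z_1,z_2)\in\mathbb{C}^2$, $$(\Delta\Phi)(f)(-z_2,z_1)=\frac{1}{2^7 3^3}\,I_2(f)\,H(f)(z_1,z_2)-\frac{1}{2^4}\,I_3(f)\,f(z_1,z_2).$$
   Context: $\mathcal{Q}_2^4$ is the complex vector space of binary quartic forms in $z_1,z_2$. For $f=a_0z_1^4+4a_1z_1^3z_2+6a_2z_1^2z_2^2+4a_3z_1z_2^3+a_4z_2^4$, the standard invariants are $I_2(f)=a_0a_4-4a_1a_3+3a_2^2$ and $I_3(f)=a_0a_2a_4+2a_1a_2a_3-a_2^3-a_0a_3^2-a_1^2a_4$ (so that for $f=az_1^4+6bz_1^2z_2^2+cz_2^4$ one has $I_2(f)=ac+3b^2$, $I_3(f)=abc-b^3$). The discriminant is normalized as $\Delta=I_2^3-27I_3^2$. $H(f)=\det(\partial^2f/\partial z_i\partial z_j)$ is the Hessian of $f$. $X_2^4=\{f\in\mathcal{Q}_2^4:\Delta(f)\neq0\}$. For $f\in X_2^4$ let $M_f=\mathbb{C}[z_1,z_2]/(\partial f/\partial z_1,\partial f/\partial z_2)$, a finite-dimensional local Gorenstein algebra whose socle is one-dimensional, equals the degree 4 part of $M_f$, and is spanned by the class of $H(f)$. Let $\omega:\mathrm{Soc}(M_f)\to\mathbb{C}$ be the linear isomorphism with $\omega(H(f))=1$ and $\mathbf{z}_j\in M_f$ the class of $z_j$. The associated form of $f$ is the quartic form on $\mathbb{C}^{2*}$ given by $\Phi(f)(z_1^*,z_2^*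 )=\omega\big((z_1^*\mathbf{z}_1+z_2^*\mathbf{z}_2)^4\big)$. The map $f\mapsto\Delta(f)\Phi(f)$ on $X_2^4$ extends (uniquely) to a polynomial map on all of $\mathcal{Q}_2^4$, denoted $\Delta\Phi$. *)

(* Defs.v *)
From HB Require Import structures.
From mathcomp Require Import all_boot all_order all_algebra.
From mathcomp Require Import boolp classical_sets functions reals.
From mathcomp Require Import generic_quotient ring_quotient complex.
From mathcomp Require Import mpoly.

Set Implicit Arguments.
Unset Strict Implicit.
Unset Printing Implicit Defensive.

Import GRing.Theory.

Local Open Scope ring_scope.
Local Open Scope complex_scope.
Local Open Scope quotient_scope.
Local Open Scope classical_set_scope.

(* The complex numbers are R[i] for a realType R. The variables z_1, z_2 are
   'X_0, 'X_1 in {mpoly R[i][2]}. *)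
Notation quartic R := (dhomog 2 R[i] 4).

Definition pt2 (T : Type) (x y : T) : 'I_2 -> T :=
  fun i => if i == 0 then x else y.

Section BinaryQuartics.
Variable R : realType.
Local Notation C := R[i].
Local Notation poly2 := {mpoly C[2]}.

(* Exponent of z_1^(4-k) z_2^k. *)
Definition qmonom (k : nat) : 'X_{1..2} :=
  [multinom if i == 0%R then (4 - k)%N else k | i < 2].

(* a_k in f = \sum_k 'C(4, k) a_k z_1^(4-k) z_2^k. *)
Definition qcoef (f : quartic R) (k : nat) : C :=
  (f : poly2)@_(qmonom k) / 'C(4, k)%:R.

Definition I2 (f : quartic R) : C :=
  let a := qcoef f in a 0 * a 4 - 4 * a 1 * a 3 + 3 * a 2 ^+ 2.

Definition I3 (f : quartic R) : C :=
  let a := qcoef f in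
  a 0 * a 2 * a 4 + 2 * a 1 * a 2 * a 3 - a 2 ^+ 3
  - a 0 * a 3 ^+ 2 - a 1 ^+ 2 * a 4.

Definition Delta (f : quartic R) : C := I2 f ^+ 3 - 27 * I3 f ^+ 2.

Definition hessian (f : quartic R) : poly2 :=
  \det (\matrix_(i < 2, j < 2) (f : poly2)^`M(i)^`M(j)).

Definition jacobian_ideal (f : quartic R) : {pred poly2} :=
  fun p => `[< exists a b : poly2,
                 p = a * (f : poly2)^`M(0) + b * (f : poly2)^`M(1) >].

Lemma jacobian_ideal_closed (f : quartic R) : idealr_closed (jacobian_ideal f).
Proof.
have d0 i : (f : poly2)^`M(i)@_0%MM = 0.
  rewrite mcoeff_deriv add0m (dhomog_nemf_coeff (mf := mdeg) (d := 4)) ?mul0rn //.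
    exact: dhomog_is_dhomog.
  by rewrite /= mdeg1.
split.
- by apply/asboolP; exists 0, 0; rewrite !mul0r addr0.
- apply/negP => /asboolP[a [b /(congr1 (mcoeff 0%MM))]].
  rewrite mcoeffD !(rmorphM (mcoeff 0%MM)) /= !d0 !mulr0 addr0 mcoeff1 eqxx.
  by move/eqP; rewrite oner_eq0.
- move=> c u v /asboolP[a [b ->]] /asboolP[a' [b' ->]]; apply/asboolP.
  exists (c * a + a'), (c * b + b').
  by rewrite mulrDr !mulrDl !mulrA addrACA.
Qed.

HB.instance Definition _ f :=
  isIdealr.Build {mpoly R[i][2]} (jacobian_ideal f) (jacobian_ideal_closed f).

(* M_f, for an arbitrary quartic f *)
Definition milnor (f : quartic R) : Type := {ideal_quot jacobian_ideal f}.
HB.instance Definition _ f := GRing.ComNzRing.on (milnor f).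

Definition milnor_class (f : quartic R) (p : poly2) : milnor f :=
  \pi_({ideal_quot jacobian_ideal f}) p.

Lemma milnor_classD f : {morph @milnor_class f : p q / p + q}.
Proof. by move=> p q; rewrite /milnor_class rmorphD. Qed.

Lemma milnor_classM f : {morph @milnor_class f : p q / p * q}.
Proof. by move=> p q; rewrite /milnor_class rmorphM. Qed.

Lemma milnor_class1 f : milnor_class f 1 = 1.
Proof. by rewrite /milnor_class rmorph1. Qed.

Definition milnor_scale f (c : C) (x : milnor f) : milnor f :=
  milnor_class f c%:MP * x.

Lemma milnor_scaleA f a b (x : milnor f) :
  milnor_scale a (milnor_scale b x) = milnor_scale (a * b) x.
Proof. by rewrite /milnor_scale mulrA -milnor_classM -mpolyCM. Qed.

Lemma milnor_scale1 f : left_id 1 (@milnor_scale f).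
Proof. by move=> x; rewrite /milnor_scale mpolyC1 milnor_class1 mul1r. Qed.

Lemma milnor_scaleDr f : right_distributive (@milnor_scale f) +%R.
Proof. by move=> c x y; rewrite /milnor_scale mulrDr. Qed.

Lemma milnor_scaleDl f (x : milnor f) :
  {morph (@milnor_scale f)^~ x : a b / a + b}.
Proof. by move=> a b; rewrite /milnor_scale mpolyCD milnor_classD mulrDl. Qed.

HB.instance Definition _ f := GRing.Zmodule_isLmodule.Build C (milnor f)
  (@milnor_scaleA f) (@milnor_scale1 f) (@milnor_scaleDr f) (@milnor_scaleDl f).

Lemma milnor_scaleAl f (c : C) (x y : milnor f) : c *: (x * y) = c *: x * y.
Proof. exact: mulrA. Qed.

HB.instance Definition _ f :=
  GRing.Lmodule_isLalgebra.Build C (milnor f) (@milnor_scaleAl f).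
HB.instance Definition _ f := GRing.Lalgebra_isComAlgebra.Build C (milnor f).

(* Annihilator of the maximal ideal of a local ring; the maximal ideal is the
   set of non-invertible elements. *)
Definition socle (A : comNzRingType) : set A :=
  [set x | forall y : A, ~ (exists y', y * y' = 1) -> y * x = 0].

(* w restricts to a linear isomorphism Soc(M_f) -> C with w(H(f)) = 1; the
   values of w outside the socle are irrelevant. *)
Definition is_omega (f : quartic R) (w : milnor f -> C) : Prop :=
  [/\ forall (c : C) (x y : milnor f), socle x -> socle y ->
        w (c *: x + y) = c * w x + w y,
      set_bij (@socle (milnor f)) [set: C] w
    & w (milnor_class f (hessian f)) = 1].

(* For Delta f != 0 such an omega exists, and it is unique on the socle. *)
Definition omega (f : quartic R) : milnor f -> C :=
  xget (fun=> 0) [set w | is_omega w].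

Definition Phi (f : quartic R) (u1 u2 : C) : C :=
  omega ((u1 *: milnor_class f 'X_0 + u2 *: milnor_class f 'X_1) ^+ 4).

Definition polynomial_map (P : quartic R -> quartic R) : Prop :=
  exists p : 'I_5 -> {mpoly C[5]},
    forall f (k : 'I_5), qcoef (P f) k = (p k).@[fun j => qcoef f j].

(* Quartic forms on the dual of C^2 are written in the dual coordinates. *)
Definition extends_DeltaPhi (P : quartic R -> quartic R) : Prop :=
  polynomial_map P /\
  forall f, Delta f != 0 ->
    forall u1 u2 : C, (P f : poly2).@[pt2 u1 u2] = Delta f * Phi f u1 u2.

(* The polynomial extension exists and is unique, so the default is unused. *)
Definition DeltaPhi : quartic R -> quartic R :=
  xget (fun=> 0) [set P | extends_DeltaPhi P].

End BinaryQuartics.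

(* Main.v *)
(* Write g_1, g_2 for the partial derivatives of f and h for its Hessian, scaled
   by constants, and J = (g_1, g_2).  The coefficient determinant of the quartics
   z_1 g_1, z_2 g_1, z_1 g_2, z_2 g_2, h is 6 Delta(f), so Cramer's rule gives
     6 Delta(f) (u z_1 + v z_2)^4 = A(u, v) h + (an element of J),
   where the cofactor A(- z_2, z_1) is the combination of I_2 H and I_3 f in the
   theorem.  It remains to see that for Delta(f) <> 0 the socle of M_f is the
   line spanned by the nonzero class of H.  As z_1^5 and z_2^5 lie in J,
   (g_1, g_2) is a regular sequence; if z_1 p and z_2 p lie in J, the relation
   z_2 (z_1 p) = z_1 (z_2 p) is therefore a Koszul syzygy e (g_2, - g_1), and
   Euler's formula g_i = h_i1 z_1 + h_i2 z_2 turns it into p = e h modulo J.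
   Finally, a polynomial extension is determined by its values off the zero set
   of Delta. *)

Require Import Defs.
From HB Require Import structures.
From mathcomp Require Import all_boot all_order all_algebra.
From mathcomp Require Import boolp classical_sets functions reals.
From mathcomp Require Import generic_quotient ring_quotient complex.
From mathcomp Require Import mpoly.
From mathcomp Require Import ring.

Set Implicit Arguments.
Unset Strict Implicit.
Unset Printing Implicit Defensive.
Import GRing.Theory.
Local Open Scope ring_scope.
Local Open Scope complex_scope.
Local Open Scope classical_set_scope.

Lemma ord2_lift0 : lift ord0 ord0 = 1 :> 'I_2.
Proof. exact: val_inj. Qed.

Lemma ord2P (i : 'I_2) : i = 0 \/ i = 1.
Proof. by case: i => [[|[|//]]] ?; [left | right]; apply: val_inj. Qed.

(** * Identities for binary quartics over a commutative ring *)

Section CoefficientAlgebra.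
Variable S : comNzRingType.
Implicit Types (a : nat -> S) (x y u v : S).

(* form2 a k and form3 a k are, up to a scalar, the partial derivatives of
   form4 a with k derivations in the second variable. *)
Definition form2 a k x y :=
  a k * x ^+ 2 + 2 * a k.+1 * (x * y) + a k.+2 * y ^+ 2.

Definition form3 a k x y :=
  a k * x ^+ 3 + 3 * a k.+1 * (x ^+ 2 * y) + 3 * a k.+2 * (x * y ^+ 2)
  + a k.+3 * y ^+ 3.

Definition form4 a x y :=
  a 0 * x ^+ 4 + 4 * a 1 * (x ^+ 3 * y) + 6 * a 2 * (x ^+ 2 * y ^+ 2)
  + 4 * a 3 * (x * y ^+ 3) + a 4 * y ^+ 4.

Definition inv2 a := a 0 * a 4 - 4 * a 1 * a 3 + 3 * a 2 ^+ 2.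

Definition inv3 a :=
  a 0 * a 2 * a 4 + 2 * a 1 * a 2 * a 3 - a 2 ^+ 3
  - a 0 * a 3 ^+ 2 - a 1 ^+ 2 * a 4.

Definition disc a := inv2 a ^+ 3 - 27 * inv3 a ^+ 2.

(* The Hessian is 24 * form4 (hess a). *)
Definition hess a : nat -> S := nth 0
  [:: 6 * (a 0 * a 2 - a 1 ^+ 2); 3 * (a 0 * a 3 - a 1 * a 2);
      a 0 * a 4 + 2 * a 1 * a 3 - 3 * a 2 ^+ 2;
      3 * (a 1 * a 4 - a 2 * a 3); 6 * (a 2 * a 4 - a 3 ^+ 2)].

(* 144 times the coefficients of Delta Phi. *)
Definition assoc a (k : nat) : S :=
  (-1) ^+ k * (inv2 a * hess a (4 - k)%N - 9 * (inv3 a * a (4 - k)%N)).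

(* The coefficients of the witnesses are cofactors of the 5x5 matrix whose rows
   are x g_1, y g_1, x g_2, y g_2, form4 (hess a), with g_i = form3 a (i - 1). *)
Lemma power4_mod_partials a x y u v : exists A B,
  6 * disc a * (u * x + v * y) ^+ 4 =
    form4 (assoc a) u v * form4 (hess a) x y
    + (A * form3 a 0 x y + B * form3 a 1 x y).
Proof.
pose a0 := a 0; pose a1 := a 1; pose a2 := a 2; pose a3 := a 3; pose a4 := a 4.
exists
 (6 * (u ^+ 4 * ((a0 ^+ 2 * a4 ^+ 3 - 11 * a0 * a1 * a3 * a4 ^+ 2 - 15 * a0
    * a2 ^+ 2 * a4 ^+ 2 + 51 * a0 * a2 * a3 ^+ 2 * a4 - 27 * a0 * a3 ^+ 4 +
    27 * a1 ^+ 2 * a2 * a4 ^+ 2 + a1 ^+ 2 * a3 ^+ 2 * a4 - 111 * a1 * a2 ^+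
    2 * a3 * a4 + 66 * a1 * a2 * a3 ^+ 3 + 54 * a2 ^+ 4 * a4 - 36 * a2 ^+ 3
    * a3 ^+ 2) * x
   + (- 3 * a0 * a1 * a4 ^+ 3 + 9 * a0 * a2 * a3 * a4 ^+ 2 - 6 * a0 * a3 ^+
    3 * a4 + 12 * a1 ^+ 2 * a3 * a4 ^+ 2 - 9 * a1 * a2 ^+ 2 * a4 ^+ 2 - 36 *
    a1 * a2 * a3 ^+ 2 * a4 + 24 * a1 * a3 ^+ 4 + 27 * a2 ^+ 3 * a3 * a4 - 18
    * a2 ^+ 2 * a3 ^+ 3) * y)
   + u ^+ 3 * v * ((24 * a0 * a1 * a2 * a4 ^+ 2 - 12 * a0 * a1 * a3 ^+ 2 *
    a4 - 48 * a0 * a2 ^+ 2 * a3 * a4 + 36 * a0 * a2 * a3 ^+ 3 - 36 * a1 ^+ 3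
    * a4 ^+ 2 + 156 * a1 ^+ 2 * a2 * a3 * a4 - 96 * a1 ^+ 2 * a3 ^+ 3 - 72 *
    a1 * a2 ^+ 3 * a4 + 48 * a1 * a2 ^+ 2 * a3 ^+ 2) * x
   + (4 * a0 ^+ 2 * a4 ^+ 3 - 20 * a0 * a1 * a3 * a4 ^+ 2 - 36 * a0 * a2 ^+
    2 * a4 ^+ 2 + 84 * a0 * a2 * a3 ^+ 2 * a4 - 36 * a0 * a3 ^+ 4 + 36 * a1
    ^+ 2 * a2 * a4 ^+ 2 - 20 * a1 ^+ 2 * a3 ^+ 2 * a4 - 36 * a1 * a2 ^+ 2 *
    a3 * a4 + 24 * a1 * a2 * a3 ^+ 3) * y)
   + u ^+ 2 * v ^+ 2 * ((- 6 * a0 ^+ 2 * a2 * a4 ^+ 2 + 18 * a0 * a1 ^+ 2 *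
    a4 ^+ 2 - 60 * a0 * a1 * a2 * a3 * a4 + 54 * a0 * a1 * a3 ^+ 3 + 54 * a0
    * a2 ^+ 3 * a4 - 54 * a0 * a2 ^+ 2 * a3 ^+ 2 - 18 * a1 ^+ 3 * a3 * a4 +
    12 * a1 ^+ 2 * a2 * a3 ^+ 2) * x
   + (- 12 * a0 ^+ 2 * a3 * a4 ^+ 2 + 72 * a0 * a1 * a2 * a4 ^+ 2 + 6 * a0 *
    a1 * a3 ^+ 2 * a4 - 108 * a0 * a2 ^+ 2 * a3 * a4 + 54 * a0 * a2 * a3 ^+
    3 - 54 * a1 ^+ 3 * a4 ^+ 2 + 90 * a1 ^+ 2 * a2 * a3 * a4 - 48 * a1 ^+ 2
    * a3 ^+ 3) * y)
   + u * v ^+ 3 * ((- 4 * a0 ^+ 2 * a1 * a4 ^+ 2 + 12 * a0 ^+ 2 * a2 * a3 *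
    a4 + 8 * a0 * a1 ^+ 2 * a3 * a4 - 12 * a0 * a1 * a2 ^+ 2 * a4 - 48 * a0
    * a1 * a2 * a3 ^+ 2 + 36 * a0 * a2 ^+ 3 * a3 + 32 * a1 ^+ 3 * a3 ^+ 2 -
    24 * a1 ^+ 2 * a2 ^+ 2 * a3) * x
   + (- 12 * a0 ^+ 2 * a2 * a4 ^+ 2 + 24 * a0 ^+ 2 * a3 ^+ 2 * a4 + 12 * a0
    * a1 ^+ 2 * a4 ^+ 2 - 120 * a0 * a1 * a2 * a3 * a4 + 12 * a0 * a1 * a3
    ^+ 3 + 108 * a0 * a2 ^+ 3 * a4 - 36 * a0 * a2 ^+ 2 * a3 ^+ 2 + 60 * a1
    ^+ 3 * a3 * a4 - 72 * a1 ^+ 2 * a2 ^+ 2 * a4 + 24 * a1 ^+ 2 * a2 * a3 ^+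
    2) * y)
   + v ^+ 4 * ((3 * a0 ^+ 2 * a1 * a3 * a4 + 3 * a0 ^+ 2 * a2 ^+ 2 * a4 - 9
    * a0 ^+ 2 * a2 * a3 ^+ 2 - 15 * a0 * a1 ^+ 2 * a2 * a4 - 3 * a0 * a1 ^+
    2 * a3 ^+ 2 + 51 * a0 * a1 * a2 ^+ 2 * a3 - 27 * a0 * a2 ^+ 4 + 9 * a1
    ^+ 4 * a4 - 30 * a1 ^+ 3 * a2 * a3 + 18 * a1 ^+ 2 * a2 ^+ 3) * x
   + (- a0 ^+ 2 * a1 * a4 ^+ 2 + 15 * a0 ^+ 2 * a2 * a3 * a4 - 18 * a0 ^+ 2
    * a3 ^+ 3 - 4 * a0 * a1 ^+ 2 * a3 * a4 - 27 * a0 * a1 * a2 ^+ 2 * a4 +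
    66 * a0 * a1 * a2 * a3 ^+ 2 - 27 * a0 * a2 ^+ 3 * a3 + 18 * a1 ^+ 3 * a2
    * a4 - 40 * a1 ^+ 3 * a3 ^+ 2 + 18 * a1 ^+ 2 * a2 ^+ 2 * a3) * y))).
exists
 (6 * (u ^+ 4 * ((- a0 ^+ 2 * a3 * a4 ^+ 2 + 15 * a0 * a1 * a2 * a4 ^+ 2 - 4
    * a0 * a1 * a3 ^+ 2 * a4 - 27 * a0 * a2 ^+ 2 * a3 * a4 + 18 * a0 * a2 *
    a3 ^+ 3 - 18 * a1 ^+ 3 * a4 ^+ 2 + 66 * a1 ^+ 2 * a2 * a3 * a4 - 40 * a1
    ^+ 2 * a3 ^+ 3 - 27 * a1 * a2 ^+ 3 * a4 + 18 * a1 * a2 ^+ 2 * a3 ^+ 2) *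
    x
   + (3 * a0 * a1 * a3 * a4 ^+ 2 + 3 * a0 * a2 ^+ 2 * a4 ^+ 2 - 15 * a0 * a2
    * a3 ^+ 2 * a4 + 9 * a0 * a3 ^+ 4 - 9 * a1 ^+ 2 * a2 * a4 ^+ 2 - 3 * a1
    ^+ 2 * a3 ^+ 2 * a4 + 51 * a1 * a2 ^+ 2 * a3 * a4 - 30 * a1 * a2 * a3 ^+
    3 - 27 * a2 ^+ 4 * a4 + 18 * a2 ^+ 3 * a3 ^+ 2) * y)
   + u ^+ 3 * v * ((- 12 * a0 ^+ 2 * a2 * a4 ^+ 2 + 12 * a0 ^+ 2 * a3 ^+ 2 *
    a4 + 24 * a0 * a1 ^+ 2 * a4 ^+ 2 - 120 * a0 * a1 * a2 * a3 * a4 + 60 *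
    a0 * a1 * a3 ^+ 3 + 108 * a0 * a2 ^+ 3 * a4 - 72 * a0 * a2 ^+ 2 * a3 ^+
    2 + 12 * a1 ^+ 3 * a3 * a4 - 36 * a1 ^+ 2 * a2 ^+ 2 * a4 + 24 * a1 ^+ 2
    * a2 * a3 ^+ 2) * x
   + (- 4 * a0 ^+ 2 * a3 * a4 ^+ 2 + 12 * a0 * a1 * a2 * a4 ^+ 2 + 8 * a0 *
    a1 * a3 ^+ 2 * a4 - 12 * a0 * a2 ^+ 2 * a3 * a4 - 48 * a1 ^+ 2 * a2 * a3
    * a4 + 32 * a1 ^+ 2 * a3 ^+ 3 + 36 * a1 * a2 ^+ 3 * a4 - 24 * a1 * a2 ^+
    2 * a3 ^+ 2) * y)
   + u ^+ 2 * v ^+ 2 * ((- 12 * a0 ^+ 2 * a1 * a4 ^+ 2 + 72 * a0 ^+ 2 * a2 *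
    a3 * a4 - 54 * a0 ^+ 2 * a3 ^+ 3 + 6 * a0 * a1 ^+ 2 * a3 * a4 - 108 * a0
    * a1 * a2 ^+ 2 * a4 + 90 * a0 * a1 * a2 * a3 ^+ 2 + 54 * a1 ^+ 3 * a2 *
    a4 - 48 * a1 ^+ 3 * a3 ^+ 2) * x
   + (- 6 * a0 ^+ 2 * a2 * a4 ^+ 2 + 18 * a0 ^+ 2 * a3 ^+ 2 * a4 - 60 * a0 *
    a1 * a2 * a3 * a4 - 18 * a0 * a1 * a3 ^+ 3 + 54 * a0 * a2 ^+ 3 * a4 + 54
    * a1 ^+ 3 * a3 * a4 - 54 * a1 ^+ 2 * a2 ^+ 2 * a4 + 12 * a1 ^+ 2 * a2 *
    a3 ^+ 2) * y)
   + u * v ^+ 3 * ((4 * a0 ^+ 3 * a4 ^+ 2 - 20 * a0 ^+ 2 * a1 * a3 * a4 - 36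
    * a0 ^+ 2 * a2 ^+ 2 * a4 + 36 * a0 ^+ 2 * a2 * a3 ^+ 2 + 84 * a0 * a1 ^+
    2 * a2 * a4 - 20 * a0 * a1 ^+ 2 * a3 ^+ 2 - 36 * a0 * a1 * a2 ^+ 2 * a3
    - 36 * a1 ^+ 4 * a4 + 24 * a1 ^+ 3 * a2 * a3) * x
   + (24 * a0 ^+ 2 * a2 * a3 * a4 - 36 * a0 ^+ 2 * a3 ^+ 3 - 12 * a0 * a1 ^+
    2 * a3 * a4 - 48 * a0 * a1 * a2 ^+ 2 * a4 + 156 * a0 * a1 * a2 * a3 ^+ 2
    - 72 * a0 * a2 ^+ 3 * a3 + 36 * a1 ^+ 3 * a2 * a4 - 96 * a1 ^+ 3 * a3 ^+
    2 + 48 * a1 ^+ 2 * a2 ^+ 2 * a3) * y)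
   + v ^+ 4 * ((- 3 * a0 ^+ 3 * a3 * a4 + 9 * a0 ^+ 2 * a1 * a2 * a4 + 12 *
    a0 ^+ 2 * a1 * a3 ^+ 2 - 9 * a0 ^+ 2 * a2 ^+ 2 * a3 - 6 * a0 * a1 ^+ 3 *
    a4 - 36 * a0 * a1 ^+ 2 * a2 * a3 + 27 * a0 * a1 * a2 ^+ 3 + 24 * a1 ^+ 4
    * a3 - 18 * a1 ^+ 3 * a2 ^+ 2) * x
   + (a0 ^+ 3 * a4 ^+ 2 - 11 * a0 ^+ 2 * a1 * a3 * a4 - 15 * a0 ^+ 2 * a2 ^+
    2 * a4 + 27 * a0 ^+ 2 * a2 * a3 ^+ 2 + 51 * a0 * a1 ^+ 2 * a2 * a4 + a0
    * a1 ^+ 2 * a3 ^+ 2 - 111 * a0 * a1 * a2 ^+ 2 * a3 + 54 * a0 * a2 ^+ 4 -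
    27 * a1 ^+ 4 * a4 + 66 * a1 ^+ 3 * a2 * a3 - 36 * a1 ^+ 2 * a2 ^+ 3) *
    y))).
rewrite /form4 /form3 /disc /assoc /inv2 /inv3 /hess /=.
rewrite /a0 /a1 /a2 /a3 /a4.
ring.
Qed.

Lemma form4_sum a x y :
  form4 a x y = \sum_(k < 5) 'C(4, k)%:R * a k * (x ^+ (4 - k) * y ^+ k).
Proof.
rewrite /form4 !big_ord_recl big_ord0 /= /bump /= bin0 bin1 binn.
rewrite (_ : 'C(4, 2) = 6)%N // (_ : 'C(4, 3) = 4)%N //.
ring.
Qed.

Lemma form4_hess a x y :
  form4 (hess a) x y =
    6 * (form2 a 0 x y * form2 a 2 x y - form2 a 1 x y ^+ 2).
Proof. rewrite /form4 /form2 /hess /=; ring. Qed.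

Lemma eq_form4 a b x y :
  (forall j, (j < 5)%N -> a j = b j) -> form4 a x y = form4 b x y.
Proof. by move=> ab; rewrite /form4 !ab. Qed.

Lemma form4Z z a x y : form4 (fun k => z * a k) x y = z * form4 a x y.
Proof. by rewrite /form4; ring. Qed.

Lemma eq_disc a b : (forall j, (j < 5)%N -> a j = b j) -> disc a = disc b.
Proof. by move=> ab; rewrite /disc /inv2 /inv3 !ab. Qed.

Lemma eq_assoc a b k :
  (forall j, (j < 5)%N -> a j = b j) -> assoc a k = assoc b k.
Proof.
by move=> ab; rewrite /assoc /hess /inv2 /inv3 !ab // ltnS leq_subr.
Qed.

(** The 12 = 4 * 3 comes from differentiating a quartic twice; 12 ^ 2 = 24 * 6 absorbs the 6 of
    [form4_hess]. *)
Lemma det_form2 a x y :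
  \det (\matrix_(i < 2, j < 2) (12 * form2 a (i + j) x y)) =
    24 * form4 (hess a) x y.
Proof.
rewrite (expand_det_row _ 0) !big_ord_recl big_ord0 /cofactor !det_mx11 !mxE.
by rewrite form4_hess /=; ring.
Qed.

(** Euler's formula: up to the factor 3, the two quadratics are the partial derivatives of the
    cubic. *)
Lemma form3_form2 a k x y :
  form3 a k x y = x * form2 a k x y + y * form2 a k.+1 x y.
Proof. rewrite /form3 /form2; ring. Qed.

(** * Derivatives of binary forms under an abstract derivation *)

Section Derivation.
Variable D : S -> S.
Hypothesis D_add : {morph D : u v / u + v}.
Hypothesis D_mul : forall u v, D (u * v) = D u * v + u * D v.

Lemma derivation1 : D 1 = 0.
Proof.
apply: (addrI (D 1)); rewrite addr0.
by have := D_mul 1 1; rewrite !mulr1 mul1r.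
Qed.

Lemma derivation_nat n : D n%:R = 0.
Proof.
have D0 : D 0 = 0 by have := D_mul 0 0; rewrite !mulr0 mul0r addr0.
by elim: n => [|n IHn]; rewrite ?mulr0n // mulrS D_add derivation1 IHn addr0.
Qed.

Lemma derivation_exp u n : D (u ^+ n.+1) = n.+1%:R * u ^+ n * D u.
Proof.
elim: n => [|n IHn]; first by rewrite expr1 expr0 !mul1r.
rewrite exprS D_mul IHn -natr1 (exprS u n).
ring.
Qed.

Definition derivationE := (D_add, D_mul, derivation_nat, derivation_exp).

Variables (a : nat -> S) (x y : S) (i : 'I_2).
Hypotheses (D_a : forall k, D (a k) = 0).
Hypotheses (D_x : D x = (0 == i)%:R) (D_y : D y = (1 == i)%:R).

Lemma derivation_form3 k : D (form3 a k x y) = 3 * form2 a (k + i) x y.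
Proof.
rewrite /form3 /form2 !derivationE !D_a D_x D_y.
by have [->|->] := ord2P i; rewrite ?addn0 ?addn1 /=; ring.
Qed.

Lemma derivation_form4 : D (form4 a x y) = 4 * form3 a i x y.
Proof.
rewrite /form4 /form3 !derivationE !D_a D_x D_y.
by have [->|->] := ord2P i; rewrite /=; ring.
Qed.

End Derivation.

(** The substitution of (- y, x) undoes the index reversal in [assoc], and its signs cancel those of
    [assoc]. *)
Lemma form4_assoc a x y :
  form4 (assoc a) (- y) x =
    inv2 a * form4 (hess a) x y - 9 * inv3 a * form4 a x y.
Proof. rewrite /form4 /assoc /=; ring. Qed.

End CoefficientAlgebra.

(** * Compatibility of the forms and invariants with ring morphisms *)

Section Morphisms.
Variables (S T : comNzRingType) (g : {rmorphism S -> T}).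
Implicit Types (a : nat -> S) (x y : S).

Lemma rmorph_form4 a x y : g (form4 a x y) = form4 (g \o a) (g x) (g y).
Proof. rewrite /form4 /=; ring. Qed.

Lemma rmorph_form2 a k x y :
  g (form2 a k x y) = form2 (g \o a) k (g x) (g y).
Proof. rewrite /form2 /=; ring. Qed.

Lemma rmorph_form3 a k x y :
  g (form3 a k x y) = form3 (g \o a) k (g x) (g y).
Proof. rewrite /form3 /=; ring. Qed.

Lemma rmorph_inv2 a : g (inv2 a) = inv2 (g \o a).
Proof. rewrite /inv2 /=; ring. Qed.

Lemma rmorph_inv3 a : g (inv3 a) = inv3 (g \o a).
Proof. rewrite /inv3 /=; ring. Qed.

Lemma rmorph_disc a : g (disc a) = disc (g \o a).
Proof. by rewrite /disc -rmorph_inv2 -rmorph_inv3; ring. Qed.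

Lemma rmorph_hess a k : g (hess a k) = hess (g \o a) k.
Proof.
by case: k => [|[|[|[|[|k]]]]]; rewrite /hess /= ?nth_nil ?rmorph0 //; ring.
Qed.

Lemma rmorph_assoc a k : g (assoc a k) = assoc (g \o a) k.
Proof.
rewrite /assoc rmorphM rmorph_sign -rmorph_inv2 -rmorph_inv3 -rmorph_hess /=.
by congr (_ * _); ring.
Qed.

End Morphisms.

(** Since 5 is odd, k + n divides k^5 + n^5 = k^5, and [l ^+ 5] inverts k^5. *)
Lemma unitD_nilpotent5 (S : comNzRingType) (k l n : S) :
  k * l = 1 -> n ^+ 5 = 0 -> exists v, (k + n) * v = 1.
Proof.
move=> kl n5.
exists (l ^+ 5 * (k ^+ 4 - k ^+ 3 * n + k ^+ 2 * n ^+ 2 - k * n ^+ 3 + n ^+ 4)).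
transitivity ((k * l) ^+ 5 + l ^+ 5 * n ^+ 5); first ring.
by rewrite kl n5 mulr0 addr0 expr1n.
Qed.

(** * The ideal of the partial derivatives: powers, syzygies and socle *)

Section PartialsIdeal.
Variables (S : idomainType) (a : nat -> S) (x y : S).

Definition partials_ideal p :=
  exists A B, p = A * form3 a 0 x y + B * form3 a 1 x y.

Lemma partials_idealD p q :
  partials_ideal p -> partials_ideal q -> partials_ideal (p + q).
Proof. by move=> [A [B ->]] [A' [B' ->]]; exists (A + A'), (B + B'); ring. Qed.

Lemma partials_idealMl q p : partials_ideal p -> partials_ideal (q * p).
Proof. by move=> [A [B ->]]; exists (q * A), (q * B); ring. Qed.

(** Euler's formulas for the two cubics form a linear system in (x, y) whose determinant is a sixth
    of the Hessian form; Cramer's rule solves it for x. *)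
Lemma partials_ideal_mulx_hess : partials_ideal (x * form4 (hess a) x y).
Proof.
exists (6 * form2 a 2 x y), (- (6 * form2 a 1 x y)).
by rewrite form4_hess !form3_form2; ring.
Qed.

Lemma partials_ideal_muly_hess : partials_ideal (y * form4 (hess a) x y).
Proof.
exists (- (6 * form2 a 1 x y)), (6 * form2 a 0 x y).
by rewrite form4_hess !form3_form2; ring.
Qed.

(** Since x and y multiply the Hessian form into the ideal, only the constant part of its
    coefficient matters. *)
Lemma partials_ideal_hess_coef p k q r :
  partials_ideal (p - (k + (q * x + r * y)) * form4 (hess a) x y) ->
  partials_ideal (p - k * form4 (hess a) x y).
Proof.
have Jx := partials_idealMl q partials_ideal_mulx_hess.
have Jy := partials_idealMl r partials_ideal_muly_hess.
move/partials_idealD/(_ (partials_idealD Jx Jy)); congr partials_ideal; ring.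
Qed.

Variable w : S.
Hypothesis disc_unit : w * (6 * disc a) = 1.

Lemma partials_ideal_pow4 u v :
  partials_ideal ((u * x + v * y) ^+ 4
    - w * form4 (assoc a) u v * form4 (hess a) x y).
Proof.
have [A [B E]] := power4_mod_partials a x y u v.
exists (w * A), (w * B).
rewrite -[_ ^+ 4]mul1r -disc_unit -[w * _ * _]mulrA E; ring.
Qed.

(** One more factor turns the Hessian term of the fourth power into multiples of x h and y h, with h
    the Hessian form. Here [u] and [v] are arbitrary ring elements; [milnor_unit] takes polynomials
    for them. *)
Lemma partials_ideal_pow5 u v : partials_ideal ((u * x + v * y) ^+ 5).
Proof.
have := partials_idealMl (u * x + v * y) (partials_ideal_pow4 u v).
set t := w * _; move/partials_idealD => H.
have Jx := partials_idealMl (u * t) partials_ideal_mulx_hess.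
have Jy := partials_idealMl (v * t) partials_ideal_muly_hess.
have := H _ (partials_idealD Jx Jy); congr partials_ideal.
by move: (form4 _ _ _) => h; ring.
Qed.

Hypothesis x_neq0 : x != 0.
Hypothesis xy_regular : forall p q, y * p = x * q -> exists r, p = x * r.

Lemma regular_exp n p q :
  y ^+ n * p = x ^+ n * q -> exists r, p = x ^+ n * r.
Proof.
(* First the power of y is stripped against a single x, then the factors x are extracted one at a
   time. *)
have reg1 m p' q' : y ^+ m * p' = x * q' -> exists r, p' = x * r.
  elim: m p' q' => [|m IHm] p' q'; first by rewrite mul1r; exists q'.
  by rewrite exprSr -mulrA => /IHm [r /xy_regular].
suff reg m p' q' : y ^+ n * p' = x ^+ m * q' -> exists r, p' = x ^+ m * r.
  exact: reg.
elim: m p' q' => [|m IHm] p' q' e; first by exists p'; rewrite mul1r.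
move: e; rewrite exprS -mulrA => /[dup] /reg1 [r ->].
rewrite mulrCA => /(mulfI x_neq0) /IHm [s ->].
by exists s; rewrite mulrA.
Qed.

(** All syzygies are Koszul. By [cancel], x^5 p and y^5 p are g2 times B p - A q and B' p - A' q;
    cancelling g2 from y^5 (x^5 p) = x^5 (y^5 p) shows that x^5 divides B p - A q, and the quotient
    is the multiplier [e]. *)
Lemma partials_regular p q :
  p * form3 a 0 x y + q * form3 a 1 x y = 0 ->
  exists e, p = e * form3 a 1 x y /\ q = - (e * form3 a 0 x y).
Proof.
have [A [B Ex]] := partials_ideal_pow5 1 0.
have [A' [B' Ey]] := partials_ideal_pow5 0 1.
move: Ex Ey; rewrite !mul1r !mul0r addr0 add0r.
set g1 := form3 a 0 x y; set g2 := form3 a 1 x y => Ex Ey E.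
have cancel c d : (c * g1 + d * g2) * p = g2 * (d * p - c * q).
  by rewrite -[RHS]addr0 -(mulr0 c) -E; ring.
have [g2_0|g2_neq0] := eqVneq g2 0; last first.
  have [r Er] : exists r, B * p - A * q = x ^+ 5 * r.
    apply: (@regular_exp _ _ (B' * p - A' * q)); apply: (mulfI g2_neq0).
    rewrite mulrCA [RHS]mulrCA -!cancel -Ex -Ey. by rewrite mulrCA.
  have Ep : p = r * g2.
    apply: (mulfI (expf_neq0 5 x_neq0)).
    by rewrite {1}Ex cancel Er mulrCA (mulrC g2).
  exists r; split=> //; apply: (mulIf g2_neq0).
  by apply/eqP; rewrite -subr_eq0 -E Ep; apply/eqP; ring.
(* If g2 = 0, both x^5 and y^5 are multiples of g1, and regularity makes g1 a unit. The syzygy then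
   forces p = 0, and e = - q / g1. *)
move: Ex Ey; rewrite g2_0 !mulr0 !addr0 => Ex Ey.
have g1_neq0 : g1 != 0.
  by apply: contraNneq (expf_neq0 5 x_neq0) => g10; rewrite Ex g10 mulr0.
have [t Et] : exists t, A = x ^+ 5 * t.
  apply: (@regular_exp _ _ A'); apply: (mulIf g1_neq0).
  by rewrite -[LHS]mulrA -[RHS]mulrA -Ex -Ey mulrC.
have tg1 : t * g1 = 1.
  by apply: (mulfI (expf_neq0 5 x_neq0)); rewrite mulr1 mulrA -Et -Ex.
exists (- (q * t)); rewrite mulr0 -mulNr opprK -mulrA tg1 mulr1; split=> //.
by apply: (mulIf g1_neq0); rewrite mul0r -E g2_0 mulr0 addr0.
Qed.

Lemma partials_socle p :
  partials_ideal (x * p) -> partials_ideal (y * p) ->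
  exists e, partials_ideal (p - e * form4 (hess a) x y).
Proof.
move=> [A [B Ex]] [A' [B' Ey]].
set g1 := form3 a 0 x y in Ex Ey *; set g2 := form3 a 1 x y in Ex Ey *.
have /partials_regular [e [Eg2 Eg1]] :
    (y * A - x * A') * g1 + (y * B - x * B') * g2 = 0.
  transitivity (y * (A * g1 + B * g2) - x * (A' * g1 + B' * g2)); first ring.
  by rewrite -Ex -Ey; ring.
(* Expanding g2 by Euler's formula in [Eg2] gives y (A - e h22) = x (A' + e h12), with h12 and h22
   the forms [form2 a 1] and [form2 a 2]; regularity applies. The companion relation for B uses g1
   in the same way. *)
have [r Er] : exists r, A - e * form2 a 2 x y = x * r.
  apply: (@xy_regular _ (A' + e * form2 a 1 x y)).
  apply/eqP; rewrite -subr_eq0; apply/eqP.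
  transitivity (y * A - x * A' - e * g2); last by rewrite Eg2 subrr.
  by rewrite /g2 form3_form2; ring.
have [s Es] : exists s, B + e * form2 a 1 x y = x * s.
  apply: (@xy_regular _ (B' - e * form2 a 0 x y)).
  apply/eqP; rewrite -subr_eq0; apply/eqP.
  transitivity (y * B - x * B' + e * g1); last by rewrite Eg1 addNr.
  by rewrite /g1 form3_form2; ring.
(* By [disc_unit], [w * disc a] serves as 1/6 and compensates the factor 6 in [form4_hess]. *)
exists (w * disc a * e), r, s; apply: (mulfI x_neq0).
transitivity (x * r * g1 + x * s * g2); last by rewrite /g1 /g2; ring.
rewrite -Er -Es mulrBr Ex form4_hess.
transitivity (A * g1 + B * g2
  - x * (w * (6 * disc a)) * e
      * (form2 a 0 x y * form2 a 2 x y - form2 a 1 x y ^+ 2)); first ring.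
by rewrite disc_unit /g1 /g2 !form3_form2; ring.
Qed.

(** If h = A g1 + B g2, comparing this expression times x with Cramer's expression for x h gives a
    syzygy, which is Koszul. *)
Lemma partials_hess : partials_ideal (form4 (hess a) x y) -> exists A B e,
  x * A - 6 * form2 a 2 x y = e * form3 a 1 x y /\
  x * B + 6 * form2 a 1 x y = - (e * form3 a 0 x y).
Proof.
move=> [A [B E]]; exists A, B.
apply: partials_regular.
transitivity (x * (A * form3 a 0 x y + B * form3 a 1 x y)
  - x * form4 (hess a) x y); last by rewrite E subrr.
by rewrite form4_hess !form3_form2; ring.
Qed.

End PartialsIdeal.

(** * Specialization of the ideal, restriction to lines and density *)

Lemma rmorph_partials_ideal (S T : idomainType) (g : {rmorphism S -> T})
    (a : nat -> S) x y p :
  partials_ideal a x y p -> partials_ideal (g \o a) (g x) (g y) (g p).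
Proof.
move=> [A [B ->]]; exists (g A), (g B).
by rewrite rmorphD !rmorphM !rmorph_form3.
Qed.

Lemma partials_ideal00 (S : idomainType) (a : nat -> S) p :
  partials_ideal a 0 0 p -> p = 0.
Proof. by move=> [A [B ->]]; rewrite /form3; ring. Qed.

(* The relations of partials_hess at x = 0. *)
Lemma hess_relations_x0 (K : idomainType) (b : nat -> K) (A B e : {poly K}) :
    6 != 0 :> K ->
    0 * A - 6 * form2 (polyC \o b) 2 0 'X = e * form3 (polyC \o b) 1 0 'X ->
    0 * B + 6 * form2 (polyC \o b) 1 0 'X = - (e * form3 (polyC \o b) 0 0 'X) ->
  b 3 = 0 /\ b 4 = 0.
Proof.
move=> n6 E2 E1.
(* At x = 0 each relation becomes z (6 + e 'X) 'X^2 = 0 with z = b 3 or z = b 4; the middle factor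
   is nonzero because its value at 0 is 6. *)
have b_eq0 z : z%:P * (6 + e * 'X) * 'X ^+ 2 = 0 -> z = 0.
  move/eqP; rewrite mulf_eq0 expf_eq0 polyX_eq0 orbF mulf_eq0 polyC_eq0.
  case/orP=> /eqP // /(congr1 (horner^~ 0)).
  rewrite hornerD hornerM hornerX mulr0 addr0 horner0 -polyC_natr hornerC.
  by move/eqP; rewrite (negbTE n6).
split; apply: b_eq0.
  transitivity (0 * B + 6 * form2 (polyC \o b) 1 0 'X
    + e * form3 (polyC \o b) 0 0 'X); last by rewrite E1 addNr.
  by rewrite /form2 /form3 /=; ring.
transitivity (e * form3 (polyC \o b) 1 0 'X
  - (0 * A - 6 * form2 (polyC \o b) 2 0 'X)); last by rewrite E2 subrr.
by rewrite /form2 /form3 /=; ring.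
Qed.

(** The quartic has the factor x^2 in this case, hence a double root. *)
Lemma disc_eq0 (S : comNzRingType) (a : nat -> S) :
  a 3 = 0 -> a 4 = 0 -> disc a = 0.
Proof. by move=> a3 a4; rewrite /disc /inv2 /inv3 a3 a4; ring. Qed.

Lemma poly_eq0_horner (K : numDomainType) (p : {poly K}) :
  (forall t, p.[t] = 0) -> p = 0.
Proof.
move=> p0; apply: (@roots_geq_poly_eq0 _ _ [seq i%:R | i <- iota 0 (size p)]).
- by apply/allP => t _; apply/rootP.
- by rewrite map_inj_uniq ?iota_uniq //; apply: Num.Theory.mulrIn; apply: oner_neq0.
- by rewrite size_map size_iota.
Qed.

(* Restriction to the line through v and a point where D does not vanish. *)
Lemma meval_eq0_dense (K : numDomainType) n (d D : {mpoly K[n]}) v0 :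
    D.@[v0] != 0 -> (forall v, D.@[v] != 0 -> d.@[v] = 0) ->
  forall v, d.@[v] = 0.
Proof.
move=> D0 dD v.
pose line t i := v i + (v0 i - v i) * t.
pose g : {rmorphism {mpoly K[n]} -> {poly K}} :=
  mmap (@polyC K) (fun i => (v i)%:P + (v0 i - v i)%:P * 'X).
have gE p t : (g p).[t] = p.@[line t].
  rewrite /g /= mevalE /mmap horner_sum; apply: eq_bigr => m _.
  rewrite hornerM hornerC /mmap1 horner_prod; congr (_ * _).
  by apply: eq_bigr => i _; rewrite horner_exp !hornerE.
(* The product vanishes at every point of the line, so one factor is zero as a polynomial in t. It
   is not that of [D], by the value at t = 1; the value at t = 0 then gives the claim. *)
have /eqP : g d * g D = 0.
  apply: poly_eq0_horner => t; rewrite hornerM !gE.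
  by have [->|/dD ->] := eqVneq (D.@[line t]) 0; rewrite ?mulr0 ?mul0r.
rewrite mulf_eq0 => /orP[] /eqP E.
  have := gE d 0; rewrite E horner0 => ->; apply: meval_eq => i.
  by rewrite /line mulr0 addr0.
have := gE D 1; rewrite E horner0 => /esym /eqP.
rewrite (@meval_eq _ _ _ v0); first by rewrite (negbTE D0).
by move=> i; rewrite /line mulr1 addrC subrK.
Qed.

(** * Quartics as polynomials in two variables and as coefficient sequences *)

Section Forms.
Variable R : realType.
Local Notation C := R[i].
Local Notation poly2 := {mpoly C[2]}.
Local Notation X := ('X_0 : poly2).
Local Notation Y := ('X_1 : poly2).
Implicit Types (f : quartic R) (p q r s : poly2).

Lemma mpolyX2E (m : 'X_{1..2}) : 'X_[m] = X ^+ m 0%R * Y ^+ m 1%R.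
Proof. by rewrite mpolyXE_id !big_ord_recl big_ord0 mulr1 ord2_lift0. Qed.

Lemma mpolyX_qmonom k : 'X_[qmonom k] = X ^+ (4 - k) * Y ^+ k :> poly2.
Proof. by rewrite mpolyX2E !mnmE. Qed.

Lemma mdeg2 (m : 'X_{1..2}) : mdeg m = (m 0%R + m 1%R)%N.
Proof.
by rewrite mdegE !big_ord_recl big_ord0 addn0 ord2_lift0.
Qed.

Lemma qmonomE (m : 'X_{1..2}) : mdeg m = 4%N -> m = qmonom (m 1%R).
Proof.
rewrite mdeg2 => m4; apply/mnmP => i; rewrite mnmE.
by have [->|->] := ord2P i; last by []; rewrite eqxx -m4 addnK.
Qed.

Lemma qmonom_inj k l : qmonom k = qmonom l -> k = l.
Proof. by move/(congr1 (fun m : 'X_{1..2} => m 1%R)); rewrite !mnmE. Qed.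

Lemma mdeg_qmonom k : (k < 5)%N -> mdeg (qmonom k) = 4%N.
Proof. by move=> k4; rewrite mdeg2 !mnmE /= subnK. Qed.

Definition qform_poly (b : nat -> C) : poly2 :=
  \sum_(k < 5) ('C(4, k)%:R * b k) *: 'X_[qmonom k].

Lemma qform_poly_homog b : qform_poly b \is 4.-homog.
Proof.
apply: rpred_sum => k _; apply: dhomogZ; rewrite dhomogX /=.
by rewrite mdeg_qmonom.
Qed.

Definition qform b : quartic R := DHomog (qform_poly_homog b).

Lemma mcoeff_qform_poly b k : (k < 5)%N ->
  (qform_poly b)@_(qmonom k) = 'C(4, k)%:R * b k.
Proof.
move=> k4; rewrite raddf_sum /= (bigD1 (Ordinal k4)) //=.
rewrite mcoeffZ mcoeffX eqxx mulr1 big1 ?addr0 // => i ik.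
rewrite mcoeffZ mcoeffX; case: eqVneq => [/qmonom_inj e|]; rewrite ?mulr0 //.
by case/eqP: ik; apply: val_inj.
Qed.

Lemma qcoef_qform b k : (k < 5)%N -> qcoef (qform b) k = b k.
Proof.
move=> k4; rewrite /qcoef /= mcoeff_qform_poly // mulrC mulKf //.
by rewrite Num.Theory.pnatr_eq0 -lt0n bin_gt0.
Qed.

Lemma quartic_qform f : (f : poly2) = qform_poly (qcoef f).
Proof.
apply/mpolyP => m; have [m4|m4] := eqVneq (mdeg m) 4%N; last first.
  have h (p : poly2) : p \is 4.-homog -> p@_m = 0.
    by move=> hp; apply: dhomog_nemf_coeff hp m4.
  by rewrite (h _ (dhomog_is_dhomog f)) (h _ (qform_poly_homog _)).
rewrite (qmonomE m4) mcoeff_qform_poly; last by rewrite ltnS -m4 mdeg2 leq_addl.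
rewrite mulrC divfK // Num.Theory.pnatr_eq0 -lt0n bin_gt0.
by rewrite -m4 mdeg2 leq_addl.
Qed.

(** This makes the ring identities above applicable, with S the polynomial ring itself and constant
    polynomials as coefficients. *)
Lemma quarticE f : (f : poly2) = form4 (@mpolyC 2 C \o qcoef f) X Y.
Proof.
rewrite {1}quartic_qform form4_sum; apply: eq_bigr => k _.
by rewrite -mul_mpolyC mpolyCM mpolyC_nat mpolyX_qmonom mulrA.
Qed.

Lemma meval_quartic f (x y : C) :
  (f : poly2).@[pt2 x y] = form4 (qcoef f) x y.
Proof.
rewrite quarticE rmorph_form4; congr (form4 _ _ _); last 2 first.
- by rewrite /= mevalXU.
- by rewrite /= mevalXU.
by apply/funext => k; apply: mevalC.
Qed.

Lemma mderivU (i j : 'I_2) : ('X_j : poly2)^`M(i) = (j == i)%:R.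
Proof.
rewrite mderivX mnm1E; case: eqP => [->|_]; last by rewrite scale0r.
by rewrite -{1}[U_(i)%MM]addm0 addmC addmK mpolyX0 scale1r.
Qed.

Lemma mderiv_quartic f (i : 'I_2) :
  (f : poly2)^`M(i) = 4 * form3 (@mpolyC 2 C \o qcoef f) i X Y.
Proof.
rewrite quarticE.
exact: (derivation_form4 (mderivD i) (mderivM i)
  (fun k => mderivC i _) (mderivU i 0) (mderivU i 1)).
Qed.

Lemma mderiv2_quartic f (i j : 'I_2) :
  (f : poly2)^`M(i)^`M(j) = 12 * form2 (@mpolyC 2 C \o qcoef f) (i + j) X Y.
Proof.
rewrite mderiv_quartic mderivM (derivation_nat (mderivD j) (mderivM j)) mul0r.
rewrite add0r (derivation_form3 (mderivD j) (mderivM j)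
  (fun k => mderivC j _) (mderivU j 0) (mderivU j 1)).
by rewrite mulrA -natrM.
Qed.

Lemma hessianE f :
  hessian f = 24 * form4 (hess (@mpolyC 2 C \o qcoef f)) X Y.
Proof.
rewrite -det_form2; congr (\det _).
by apply/matrixP => i j; rewrite !mxE mderiv2_quartic.
Qed.

Lemma mpoly2_decomp p : exists q r, p = (p@_0%MM)%:MP + (q * X + r * Y).
Proof.
elim/mpolyind: p => [|c m p _ _ [q [r E]]].
  by exists 0, 0; rewrite mcoeff0 mpolyC0 !mul0r !addr0.
suff [q' [r' E']] : exists q r, 'X_[m] = ('X_[m]@_0%MM)%:MP + (q * X + r * Y).
  exists (c *: q' + q), (c *: r' + r).
  rewrite mcoeffD mcoeffZ mpolyCD mpolyCM mul_mpolyC {1}E' {1}E !scalerDr.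
  by rewrite !mulrDl !scalerAl addrACA; congr (_ + _); rewrite addrACA.
have [->|m0] := eqVneq m 0%MM.
  by exists 0, 0; rewrite mpolyX0 mcoeff1 eqxx mulr1n mpolyC1 !mul0r !addr0.
rewrite mcoeffX (negbTE m0) mpolyC0 mpolyX2E.
case m0E : (m 0%R) => [|i]; last first.
  by exists (X ^+ i * Y ^+ m 1%R), 0; rewrite add0r mul0r addr0 exprSr mulrAC.
case m1E : (m 1%R) => [|j]; last first.
  by exists 0, (Y ^+ j); rewrite !add0r mul0r add0r expr0 mul1r exprSr.
by case/eqP: m0; apply/mnmP => i; rewrite mnm0E; have [->|->] := ord2P i.
Qed.

(** Multiplication by z_2 leaves exponents of z_1 unchanged, so every monomial of [p] contains z_1
    and can be divided by it. *)
Lemma mpoly2_regular p q : Y * p = X * q -> exists r, p = X * r.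
Proof.
rewrite ![_ * p]mulrC ![_ * q]mulrC => e.
have m_gt0 m : m \in msupp p -> (0 < m 0%R)%N.
  move=> pm; have : (U_(1) + m)%MM \in msupp (q * X).
    by rewrite -e (perm_mem (msuppMX _ _)) map_f.
  rewrite (perm_mem (msuppMX _ _)) => /mapP[m' _] /mnmP/(_ 0%R).
  by rewrite !mnmDE !mnm1E /= add0n => ->.
exists (\sum_(m <- msupp p) p@_m *: 'X_[m - U_(0)]).
rewrite mulr_sumr {1}[p]mpolyE; apply: eq_big_seq => m /m_gt0 m0.
rewrite -scalerAr -mpolyXD addmC submK //; apply/mnm_lepP => i.
by rewrite mnm1E; case: eqP => // <-.
Qed.

(** * The Milnor algebra, its units and its socle *)

Section MilnorAlgebra.
Variables (f : quartic R).
Local Notation c := (@mpolyC 2 C \o qcoef f).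
Local Notation jac := (partials_ideal c X Y).
Local Notation h := (form4 (hess c) X Y).
Local Notation cls := (@milnor_class R f).

Lemma jacobian_partials p : (p \in jacobian_ideal f) <-> jac p.
Proof.
have t4 u v : (4^-1 : C)%:MP * u * (4 * v) = u * v :> poly2.
  rewrite mulrACA -[X in _ * X * _]mpolyC_nat -mpolyCM mulVf ?mpolyC1 ?mul1r //.
  by rewrite Num.Theory.pnatr_eq0.
split=> [/asboolP[A [B ->]]|[A [B ->]]].
  by exists (A * 4), (B * 4); rewrite !mderiv_quartic -(mulrA A) -(mulrA B).
apply/asboolP; exists ((4^-1)%:MP * A), ((4^-1)%:MP * B).
by rewrite !mderiv_quartic !t4.
Qed.

Lemma milnor_class_eq p q : cls p = cls q <-> jac (p - q).
Proof.
rewrite -jacobian_partials /milnor_class; split=> [e|].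
  by rewrite Quotient.idealrBE; apply/eqP.
by rewrite Quotient.idealrBE => /eqP.
Qed.

Lemma milnor_class0 : cls 0 = 0.
Proof. by rewrite /milnor_class rmorph0. Qed.

Lemma milnor_class_eq0 p : cls p = 0 <-> jac p.
Proof. by rewrite -milnor_class0 milnor_class_eq subr0. Qed.

Lemma milnor_class_surj (x : milnor f) : exists p, x = cls p.
Proof. by exists (repr x); rewrite /milnor_class reprK. Qed.

Lemma milnor_classX n : {morph cls : p / p ^+ n}.
Proof. by move=> p; rewrite /milnor_class rmorphXn. Qed.

Lemma milnor_scale_class k p : k *: cls p = cls (k%:MP * p).
Proof. by rewrite milnor_classM. Qed.

Lemma partials_ideal_meval0 p : jac p -> p.@[fun=> 0] = 0.
Proof.
pose g : {rmorphism poly2 -> C} := meval (fun=> 0).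
have gU i : g 'X_i = 0 by apply: mevalXU.
by move/(rmorph_partials_ideal g); rewrite !gU => /partials_ideal00.
Qed.

Lemma hess_hessian (k : C) : k%:MP * hessian f = (24 * k)%:MP * h.
Proof. by rewrite hessianE mulrA (mulrC 24) mpolyCM mpolyC_nat. Qed.

Lemma hessian_hess (k : C) : (24^-1 * k)%:MP * hessian f = k%:MP * h.
Proof. by rewrite hess_hessian mulVKf // Num.Theory.pnatr_eq0. Qed.

Lemma jac_mulX_hessian (k : C) : jac (X * (k%:MP * hessian f)).
Proof.
rewrite hess_hessian mulrCA; apply: partials_idealMl.
exact: partials_ideal_mulx_hess.
Qed.

Lemma jac_mulY_hessian (k : C) : jac (Y * (k%:MP * hessian f)).
Proof.
rewrite hess_hessian mulrCA; apply: partials_idealMl.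
exact: partials_ideal_muly_hess.
Qed.

(** The Jacobian ideal vanishes at the origin, so an inverse in the quotient would give an inverse
    of the value there. *)
Lemma milnor_nonunit_jac p :
  (forall q : poly2, p.@[fun=> 0] * q.@[fun=> 0] != 1) ->
  ~ exists y, cls p * y = 1.
Proof.
move=> pN [y]; have [q ->] := milnor_class_surj y.
rewrite -milnor_classM -milnor_class1 milnor_class_eq.
move/partials_ideal_meval0; rewrite rmorphB rmorphM rmorph1 => /eqP.
by rewrite subr_eq0 (negbTE (pN q)).
Qed.

Lemma milnor_X_nonunit (i : 'I_2) : ~ exists y, cls 'X_i * y = 1.
Proof.
by apply: milnor_nonunit_jac => q; rewrite mevalXU mul0r eq_sym oner_eq0.
Qed.

Hypothesis Delta_neq0 : Delta f != 0.
Local Notation w := (((6 * Delta f)^-1)%:MP : poly2).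

Lemma disc_poly_unit : w * (6 * disc c) = 1.
Proof.
rewrite -rmorph_disc -mpolyC_nat -!mpolyCM mulVf ?mpolyC1 //.
by rewrite mulf_neq0 // Num.Theory.pnatr_eq0.
Qed.

Let X_neq0 : X != 0.
Proof. by rewrite -msupp_eq0 msuppX. Qed.

(** The class is an invertible constant plus q z_1 + r z_2, whose fifth power lies in the ideal. *)
Lemma milnor_unit p : p@_0%MM != 0 -> exists y, cls p * y = 1.
Proof.
have [q [r E]] := mpoly2_decomp p => p0.
rewrite E milnor_classD.
apply: (@unitD_nilpotent5 _ _ (cls (p@_0%MM)^-1%:MP)).
  by rewrite -milnor_classM -mpolyCM mulfV // mpolyC1 milnor_class1.
rewrite -milnor_classX; apply/milnor_class_eq0.
exact: (partials_ideal_pow5 X Y disc_poly_unit).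
Qed.

(** Otherwise the relations of [partials_hess], restricted to the line z_1 = 0 by [g], force a_3 =
    a_4 = 0, against Delta(f) <> 0. *)
Lemma hessian_notin_jac : ~ jac (hessian f).
Proof.
move/(partials_idealMl (24^-1 * 1)%:MP).
rewrite hessian_hess mpolyC1 mul1r.
move=> /(partials_hess disc_poly_unit X_neq0 mpoly2_regular).
move=> [A [B [e [E2 E1]]]].
pose g : {rmorphism poly2 -> {poly C}} := mmap (@polyC C) (pt2 0 'X).
have gX : g X = 0 by rewrite /g /= mmapX mmap1U.
have gY : g Y = 'X by rewrite /g /= mmapX mmap1U.
have gc : g \o c = polyC \o qcoef f by apply/funext => k; apply: mmapC.
move/(congr1 g): E2; rewrite rmorphB !rmorphM rmorph_nat.
rewrite rmorph_form2 rmorph_form3 gX gY gc => E2.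
move/(congr1 g): E1; rewrite rmorphD rmorphN !rmorphM rmorph_nat.
rewrite rmorph_form2 rmorph_form3 gX gY gc => E1.
have [] := hess_relations_x0 _ E2 E1; first by rewrite Num.Theory.pnatr_eq0.
by move=> a3 a4; case/eqP: Delta_neq0; apply: disc_eq0.
Qed.

Lemma milnor_socleP (x : milnor f) :
  socle x <-> exists k : C, x = cls (k%:MP * hessian f).
Proof.
split=> [sx|[k ->] y yN]; last first.
  have [q Ey] := milnor_class_surj y; rewrite {}Ey in yN *.
  rewrite -milnor_classM; apply/milnor_class_eq0.
  have [r [s E]] := mpoly2_decomp q.
  (* A nonunit has no constant term, so it is a combination of z_1 and z_2, and each of these kills
     the Hessian. *)
  have [q0|/milnor_unit //] := eqVneq (q@_0%MM) 0.
  rewrite E q0 mpolyC0 add0r mulrDl -!mulrA.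
  by apply: partials_idealD; apply: partials_idealMl;
    [apply: jac_mulX_hessian | apply: jac_mulY_hessian].
have [p Ex] := milnor_class_surj x; rewrite {}Ex in sx *.
have jU i : jac ('X_i * p).
  by apply/milnor_class_eq0; rewrite milnor_classM; apply/sx/milnor_X_nonunit.
have [e He] := partials_socle disc_poly_unit X_neq0 mpoly2_regular
  (jU 0) (jU 1).
have [q [r E]] := mpoly2_decomp e.
exists (24^-1 * e@_0%MM); apply/milnor_class_eq.
(* The coefficient [e] is a polynomial, but modulo the ideal only its constant term counts; 1/24
   passes from h to the Hessian. *)
by rewrite hessian_hess; move: He; rewrite {1}E => /partials_ideal_hess_coef.
Qed.

End MilnorAlgebra.

(** * The functional omega and the associated form *)

Section AssociatedForm.
Variable f : quartic R.
Hypothesis Delta_neq0 : Delta f != 0.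
Local Notation cls := (@milnor_class R f).
Local Notation c := (@mpolyC 2 C \o qcoef f).

Lemma milnor_hessian_inj k l :
  cls (k%:MP * hessian f) = cls (l%:MP * hessian f) -> k = l.
Proof.
move/milnor_class_eq; rewrite -mulrBl -mpolyCB => kl.
apply/eqP; rewrite -subr_eq0; apply: contrapT => /negP kl0.
apply: (hessian_notin_jac Delta_neq0).
have := partials_idealMl ((k - l)^-1)%:MP kl.
by rewrite mulrA -mpolyCM mulVf // mpolyC1 mul1r.
Qed.

Lemma is_omega_omega : is_omega (@omega R f).
Proof.
(* The witness reads off the coordinate along the Hessian class; off the socle it takes the default
   0. *)
pose w x : C := xget 0 [set k | x = cls (k%:MP * hessian f)].
have wE k : w (cls (k%:MP * hessian f)) = k.
  by apply: xget_unique => //= l /milnor_hessian_inj.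
apply: (@xgetI _ _ [set w | is_omega w] w); rewrite /=.
split.
- move=> k x y /(milnor_socleP Delta_neq0)[l ->] /(milnor_socleP Delta_neq0)[m ->].
  rewrite milnor_scale_class mulrA -mpolyCM -milnor_classD -mulrDl -mpolyCD.
  by rewrite !wE.
- split=> //.
    move=> x y; rewrite !inE => /(milnor_socleP Delta_neq0)[l ->].
    by move=> /(milnor_socleP Delta_neq0)[m ->]; rewrite !wE => ->.
  move=> k _; exists (cls (k%:MP * hessian f)); last exact: wE.
  by apply/(milnor_socleP Delta_neq0); exists k.
- by rewrite -[hessian f]mul1r -mpolyC1 wE.
Qed.

(** As [omega] is obtained by choice, its values on the socle are derived from linearity and
    normalization alone. *)
Lemma omega_hessian k : omega (cls (k%:MP * hessian f)) = k.
Proof.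
have [lin _ w1] := is_omega_omega.
have sH l : socle (cls (l%:MP * hessian f)).
  by apply/(milnor_socleP Delta_neq0); exists l.
have s0 : socle (0 : milnor f) by move=> y _; rewrite mulr0.
have s1 : socle (cls (hessian f)) by have := sH 1; rewrite mpolyC1 mul1r.
have w0 : omega (0 : milnor f) = 0.
  have := lin 1 0 0 s0 s0; rewrite scale1r addr0 mul1r => e.
  by apply: (addrI (omega (0 : milnor f))); rewrite addr0 -e.
by rewrite -milnor_scale_class -[_ *: _]addr0 lin // w0 w1 mulr1 addr0.
Qed.

Lemma form4_assoc_polyC u v :
  form4 (assoc c) u%:MP v%:MP = (form4 (assoc (qcoef f)) u v)%:MP :> poly2.
Proof.
have := rmorph_form4 (@mpolyC 2 C) (assoc (qcoef f)) u v.
have -> : @mpolyC 2 C \o assoc (qcoef f) = assoc c.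
  by apply/funext => k; exact: (rmorph_assoc (@mpolyC 2 C)).
by move=> <-.
Qed.

(** Here 144 = 6 * 24: the 6 comes from [power4_mod_partials], the 24 from the ratio of the Hessian
    to [form4 (hess c)]. *)
Lemma Delta_Phi u v :
  Delta f * Phi f u v = 144^-1 * form4 (assoc (qcoef f)) u v.
Proof.
have -> : Phi f u v =
    24^-1 * ((6 * Delta f)^-1 * form4 (assoc (qcoef f)) u v).
  rewrite /Phi !milnor_scale_class -milnor_classD -milnor_classX.
  rewrite -[RHS]omega_hessian; congr omega; apply/milnor_class_eq.
  have := partials_ideal_pow4 X Y (disc_poly_unit Delta_neq0) u%:MP v%:MP.
  by rewrite form4_assoc_polyC -mpolyCM -hessian_hess.
by field.
Qed.

End AssociatedForm.

(** * The polynomial extension and its uniqueness *)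

Lemma meval_form4 n (v : 'I_n -> C) (a : nat -> {mpoly C[n]}) (x y : C) :
  (form4 a x%:MP y%:MP).@[v] = form4 (fun k => (a k).@[v]) x y.
Proof.
have := rmorph_form4 (meval v) a x%:MP y%:MP.
by rewrite /= !mevalC.
Qed.

(** Coefficients of the universal quartic, indexed by [nat] as the identities require; only indices
    below 5 matter. *)
Definition generic_coef (k : nat) : {mpoly C[5]} := 'X_(inord k).

Lemma meval_generic_coef (v : 'I_5 -> C) :
  (fun k => (generic_coef k).@[v]) = v \o inord.
Proof. by apply/funext => k; rewrite mevalXU. Qed.

Lemma meval_generic_assoc (v : 'I_5 -> C) k :
  (assoc generic_coef k).@[v] = assoc (v \o inord) k.
Proof.
by have := rmorph_assoc (meval v) generic_coef k; rewrite -meval_generic_coef.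
Qed.

Lemma meval_generic_disc (v : 'I_5 -> C) :
  (disc generic_coef).@[v] = disc (v \o inord).
Proof.
by have := rmorph_disc (meval v) generic_coef; rewrite -meval_generic_coef.
Qed.

Definition assoc_form (f : quartic R) : quartic R :=
  qform (fun k => 144^-1 * assoc (qcoef f) k).

Lemma meval_assoc_form f u v :
  (assoc_form f : poly2).@[pt2 u v] = 144^-1 * form4 (assoc (qcoef f)) u v.
Proof.
rewrite meval_quartic -form4Z; apply: eq_form4 => k k5.
by rewrite qcoef_qform.
Qed.

Lemma assoc_form_extends : extends_DeltaPhi assoc_form.
Proof.
split=> [|f f0 u v]; last by rewrite meval_assoc_form Delta_Phi.
exists (fun k => (144^-1)%:MP * assoc generic_coef k) => f k.
rewrite qcoef_qform // mevalM mevalC meval_generic_assoc; congr (_ * _).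
by apply: eq_assoc => j j5; rewrite /= inordK.
Qed.

(** For fixed (u, v), the difference of the two sides is a polynomial in the five coefficients. It
    vanishes wherever the discriminant does not, hence everywhere by density. *)
Lemma extends_DeltaPhi_unique P f u v : extends_DeltaPhi P ->
  (P f : poly2).@[pt2 u v] = 144^-1 * form4 (assoc (qcoef f)) u v.
Proof.
move=> [[p Ep] PD].
have qform_inord (a : 'I_5 -> C) (j : nat) : (j < 5)%N ->
    qcoef (qform (a \o inord)) j = a (inord j).
  by move=> j5; rewrite qcoef_qform.
pose d : {mpoly C[5]} := form4 (fun k => p (inord k)) u%:MP v%:MP
  - (144^-1)%:MP * form4 (assoc generic_coef) u%:MP v%:MP.
have dE g : d.@[fun j => qcoef g j] =
    (P g : poly2).@[pt2 u v] - 144^-1 * form4 (assoc (qcoef g)) u v.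
  rewrite /d mevalB; congr (_ - _).
    rewrite meval_form4 meval_quartic; apply: eq_form4 => k k5.
    by rewrite -Ep inordK.
  rewrite mevalM mevalC meval_form4; congr (_ * _).
  apply: eq_form4 => k _; rewrite meval_generic_assoc.
  by apply: eq_assoc => j j5; rewrite /= inordK.
apply/eqP; rewrite -subr_eq0 -dE; apply/eqP.
(* The base point is z_1^4 + z_2^4, with I_2 = 1, I_3 = 0 and discriminant 1. *)
apply: (@meval_eq0_dense _ _ d (disc generic_coef)
  (fun j : 'I_5 => (((j : nat) == 0) || ((j : nat) == 4))%N%:R)).
  rewrite meval_generic_disc (@eq_disc _ _ (fun j => ((j == 0) || (j == 4))%N%:R)).
    rewrite (_ : disc _ = 1) ?oner_neq0 // /disc /inv2 /inv3 /=; ring.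
  by move=> j j5; rewrite /= inordK.
move=> a; rewrite meval_generic_disc => Da.
have -> : d.@[a] = d.@[fun j => qcoef (qform (a \o inord)) j].
  by apply: meval_eq => j; rewrite qcoef_qform //= inord_val.
have Df : Delta (qform (a \o inord)) != 0.
  rewrite (_ : Delta _ = disc (a \o inord)) //; apply: (@eq_disc _ (qcoef _)).
  by move=> j j5; rewrite qcoef_qform.
by rewrite dE PD // Delta_Phi // subrr.
Qed.

Lemma meval_DeltaPhi f u v :
  (DeltaPhi f : poly2).@[pt2 u v] = 144^-1 * form4 (assoc (qcoef f)) u v.
Proof.
exact: extends_DeltaPhi_unique (xgetI _ assoc_form_extends).
Qed.

Lemma meval_hessian f u v :
  (hessian f).@[pt2 u v] = 24 * form4 (hess (qcoef f)) u v.
Proof.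
rewrite hessianE mevalM -mpolyC_nat mevalC; congr (_ * _).
rewrite rmorph_form4; congr (form4 _ _ _); last 2 first.
- by rewrite /= mevalXU.
- by rewrite /= mevalXU.
apply/funext => k; rewrite [LHS](rmorph_hess (meval (pt2 u v))).
by congr (hess _ _); apply/funext => j; apply: mevalC.
Qed.

End Forms.

Theorem mainTheorem3 (R : realType) (f : quartic R) (z1 z2 : R[i]) :
  (DeltaPhi f : {mpoly R[i][2]}).@[pt2 (- z2) z1] =
    (2 ^+ 7 * 3 ^+ 3)^-1 * I2 f * (hessian f).@[pt2 z1 z2]
    - (2 ^+ 4)^-1 * I3 f * (f : {mpoly R[i][2]}).@[pt2 z1 z2].
Proof.
rewrite meval_DeltaPhi form4_assoc meval_hessian meval_quartic.
rewrite -[inv2 _]/(I2 f) -[inv3 _]/(I3 f).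
(* The constants are 144 * 24 = 2^7 * 3^3 and 9 / 144 = 1 / 2^4. *)
by field.
Qed.
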